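(* Let $n\ge 1$. (1) For every convex body $K\subset\mathbb{R}^n$, $$\mathrm{vol}(K)\le 2^n\prod_{i=1}^n\lambda_i(\mathrm{cs}(K)^\star),$$ and the inequality is best possible (the constant $2^n$ cannot be replaced by a smaller one). (2) For every convex body $K\subset\mathbb{R}^n$ whose centroid is at the origin, $$\mathrm{vol}(K)\le \frac{(n+1)^n}{n!}\prod_{i=1}^n\lambda_i(K^\star),$$ and the inequality is best possible (the constant $(n+1)^n/n!$ cannot be replaced by a smaller one). (3) For arbitrary convex bodies $K\subset\mathbb{R}^n$ with the origin in the interior, the volume is in general not bounded from above by the product of the $\lambda_i(K^\star)$; that is, there is no constant $c$ (depending only on $n$) such that $\mathrm{vol}(K)\le c\prod_{i=1}^n\lambda_i(K^\star)$ for all convex bodies $K\subset\mathbb{R}^n$ containing the origin in their interior.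
   Context: A convex body in $\mathbb{R}^n$ is a compact convex set with non-empty interior; $\mathrm{vol}$ is $n$-dimensional Lebesgue measure. The central symmetral of $K$ is $\mathrm{cs}(K)=\frac12(K-K)=\{\frac12(x-y):x,y\in K\}$; it is origin-symmetric with the origin in its interior. The polar body of $L$ is $L^\star=\{y\in\mathbb{R}^n:\langle x,y\rangle\le 1\text{ for all }x\in L\}$. For a convex body $L$ with the origin in its interior (not necessarily symmetric), the $i$-th successive minimum $\lambda_i(L)$, $1\le i\le n$, is the smallest $\lambda>0$ such that $\lambda L$ contains $i$ linearly independent points of $\mathbb{Z}^n$. *)

(* Defs.v *)
From HB Require Import structures.
From mathcomp Require Import all_boot all_order all_algebra.
From mathcomp Require Import all_classical all_reals all_analysis.

Set Implicit Arguments.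
Unset Strict Implicit.
Unset Printing Implicit Defensive.

Import Order.TTheory GRing.Theory Num.Theory.
Import numFieldNormedType.Exports.

Local Open Scope classical_set_scope.
Local Open Scope ring_scope.

Definition rV_display : measure_display.
Proof. exact: (measure_tuple_display default_measure_display). Qed.

Section measurable_rV.
Context (R : realType) (n : nat).

Let coord : 'I_n -> 'rV[R]_n -> measurableTypeR R := fun i x => x ord0 i.

Let rV_set0 : g_sigma_preimage coord set0.
Proof. exact: sigma_algebra0. Qed.

Let rV_setC A : g_sigma_preimage coord A -> g_sigma_preimage coord (~` A).
Proof. exact: sigma_algebraC. Qed.

Let rV_bigcup (F : _^nat) : (forall i, g_sigma_preimage coord (F i)) ->
  g_sigma_preimage coord (\bigcup_i (F i)).
Proof. exact: sigma_algebra_bigcup. Qed.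

(* The product sigma-algebra (generated by the coordinates, as the library does
   for tuples), which on R^n is the Borel sigma-algebra. *)
HB.instance Definition _ := @isMeasurable.Build rV_display 'rV[R]_n
  (g_sigma_preimage coord) rV_set0 rV_setC rV_bigcup.

Lemma measurable_coord (i : 'I_n) :
  measurable_fun [set: 'rV[R]_n]
    (fun x : 'rV[R]_n => x ord0 i : measurableTypeR R).
Proof.
move=> _ Y mY; rewrite setTI; apply: sub_sigma_algebra => /=.
rewrite -bigcup_seq/=; exists i => /=; first by rewrite mem_index_enum.
by exists Y => //; rewrite setTI.
Qed.

Lemma measurable_fun_coord d (T : measurableType d) (f : T -> 'rV[R]_n) :
  (forall i, measurable_fun [set: T]
    (fun x => f x ord0 i : measurableTypeR R)) ->
  measurable_fun [set: T] f.
Proof.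
move=> mf; apply: (@measurability _ _ _ _ _ _ (\big[setU/set0]_(i < n)
  preimage_set_system setT (coord i) measurable)) => // A [B mB <-].
move: mB; rewrite -bigcup_seq/= => -[i _ [C mC <-]].
by rewrite !setTI; have := mf i measurableT C mC; rewrite setTI.
Qed.

End measurable_rV.

Section lebesgue_rV.
Context {R : realType}.

Definition rV_cons n (p : measurableTypeR R * 'rV[R]_n) : 'rV[R]_n.+1 :=
  \row_i if unlift ord0 i is Some j then p.2 ord0 j else p.1.

Definition rV_uncons n (x : 'rV[R]_n.+1) : measurableTypeR R * 'rV[R]_n :=
  (x ord0 ord0, \row_i x ord0 (lift ord0 i)).

Lemma rV_cons0 n (p : measurableTypeR R * 'rV[R]_n) :
  rV_cons p ord0 ord0 = p.1.
Proof. by rewrite mxE unlift_none. Qed.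

Lemma rV_consS n (p : measurableTypeR R * 'rV[R]_n) (i : 'I_n) :
  rV_cons p ord0 (lift ord0 i) = p.2 ord0 i.
Proof. by rewrite mxE liftK. Qed.

Lemma rV_consK n : cancel (@rV_cons n) (@rV_uncons n).
Proof.
move=> p; rewrite [LHS]surjective_pairing [RHS]surjective_pairing.
congr pair; first exact: rV_cons0.
by apply/rowP => i; rewrite mxE rV_consS.
Qed.

Lemma measurable_rV_cons n : measurable_fun setT (@rV_cons n).
Proof.
apply: measurable_fun_coord => i; case: (unliftP ord0 i) => [j|] ->.
  under eq_fun do rewrite rV_consS.
  exact: measurableT_comp (@measurable_coord R n j) measurable_snd.
by under eq_fun do rewrite rV_cons0; exact: measurable_fst.
Qed.

Lemma measurable_rV_uncons n : measurable_fun setT (@rV_uncons n).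
Proof.
apply: measurable_fun_pair; first exact: measurable_coord.
apply: measurable_fun_coord => i; under eq_fun do rewrite mxE.
exact: measurable_coord.
Qed.

Section prod_rV.
Local Open Scope ereal_scope.
Variables (n : nat) (mu : {sigma_finite_measure set 'rV[R]_n -> \bar R}).

Definition prod_rV := pushforward (lebesgue_measure \x mu) (@rV_cons n).

Let prod_rV0 : prod_rV set0 = 0.
Proof. by rewrite /prod_rV /pushforward preimage_set0 measure0. Qed.

Let prod_rV_ge0 A : 0 <= prod_rV A.
Proof. exact: (measure_ge0 (lebesgue_measure \x mu)). Qed.

Let prod_rV_sigma_additive : semi_sigma_additive prod_rV.
Proof.
exact: (@measure_semi_sigma_additive _ _ _
  (measure_function_pushforward__canonical__measure_function_Measure
    (lebesgue_measure \x mu) (@measurable_rV_cons n))).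
Qed.

HB.instance Definition _ := isMeasure.Build _ _ _ prod_rV
  prod_rV0 prod_rV_ge0 prod_rV_sigma_additive.

Let prod_rV_sigma_finite : sigma_finite setT prod_rV.
Proof.
have /sigma_finiteP[F [TF ndF Foo]] := sigma_finiteT (@lebesgue_measure R).
have /sigma_finiteP[G [TG ndG Goo]] := sigma_finiteT mu.
exists (fun k => @rV_uncons n @^-1` (F k `*` G k)).
  rewrite -preimage_bigcup; apply/esym; rewrite -subTset => x _.
  have [i _ Fi] : (\bigcup_k F k) (rV_uncons x).1 by rewrite -TF.
  have [j _ Gj] : (\bigcup_k G k) (rV_uncons x).2 by rewrite -TG.
  exists (maxn i j) => //; split.
    by move: Fi; exact/subsetPset/ndF/leq_maxl.
  by move: Gj; exact/subsetPset/ndG/leq_maxr.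
move=> k; have [mF Fk] := Foo k; have [mG Gk] := Goo k.
have mFG := measurableX mF mG; split.
  by rewrite -[X in measurable X]setTI; exact: measurable_rV_uncons.
rewrite /prod_rV /pushforward -comp_preimage (_ : _ \o _ = id); last first.
  by apply/funext => p /=; rewrite rV_consK.
by rewrite product_measure1E// lte_mul_pinfty// ge0_fin_numE.
Qed.

HB.instance Definition _ := Measure_isSigmaFinite.Build _ _ _ prod_rV
  prod_rV_sigma_finite.

End prod_rV.

(* n-dimensional Lebesgue measure, as an iterated product. *)
Fixpoint lebesgue_rV n : {sigma_finite_measure set 'rV[R]_n -> \bar R} :=
  match n with
  | 0 => \d_(0 : 'rV[R]_0)
  | m.+1 => prod_rV (lebesgue_rV m)
  end.

Lemma lebesgue_rV_box n (A : 'I_n -> set (measurableTypeR R)) :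
  (forall i, measurable (A i)) ->
  lebesgue_rV n [set x : 'rV[R]_n | forall i, A i (x ord0 i)] =
  (\prod_(i < n) lebesgue_measure (A i))%E.
Proof.
elim: n A => [|n IHn] A mA /=.
  by rewrite big_ord0 diracE mem_set// => -[].
rewrite big_ord_recl /prod_rV /pushforward.
rewrite -IHn => [|i]; last exact: mA.
rewrite -product_measure1E//; last first.
  rewrite [X in measurable X](_ : _ = \big[setI/setT]_(i < n)
    ((fun y : 'rV[R]_n => y ord0 i : measurableTypeR R) @^-1`
      A (lift ord0 i))).
    apply: bigsetI_measurable => i _; rewrite -[X in measurable X]setTI.
    exact: measurable_coord.
  rewrite -bigcap_seq; apply/seteqP; split => x /= Ax i; first by move=> _; exact: Ax.
  by apply: Ax => /=; rewrite mem_index_enum.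
congr (_ _); apply/seteqP; split => [p Ap|p [/= Ap1 Ap2] i] /=.
  split=> /= [|i]; first by rewrite -(rV_cons0 p); exact: Ap.
  by rewrite -(rV_consS p); exact: Ap.
by case: (unliftP ord0 i) => [j|] ->; rewrite ?rV_consS ?rV_cons0.
Qed.

End lebesgue_rV.

Section convex_bodies.
Context {R : realType} {n : nat}.
Implicit Types (K L : set 'rV[R]_n).

Definition vol K : \bar R := lebesgue_rV n K.

Definition centroid K : 'rV[R]_n :=
  \row_i (\int[lebesgue_rV n]_(x in K) (x ord0 i) / fine (vol K)).

Definition convex_body K : Prop :=
  [/\ compact K, convex_set (K : set (convex_lmodType 'rV[R]_n))
    & interior K !=set0].

Definition central_symmetral K : set 'rV[R]_n :=
  [set 2^-1 *: (x - y) | x in K & y in K].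

Definition polar L : set 'rV[R]_n :=
  [set y | forall x, L x -> \sum_i x ord0 i * y ord0 i <= 1].

Definition dilate (l : R) L : set 'rV[R]_n := [set l *: x | x in L].

(* L contains i points of Z^n, linearly independent over R: the rows of Z. *)
Definition has_free_lattice_points L (i : nat) : Prop :=
  exists Z : 'M[int]_(i, n),
    row_free (map_mx intr Z : 'M[R]_(i, n)) /\
    forall j, L (row j (map_mx intr Z)).

(* The smallest element of the set below, or 0 if there is none; there is one
   whenever 1 <= i <= n and L is a convex body with 0 in its interior. *)
Definition successive_minimum L (i : nat) : R :=
  let S := [set l : R | 0 < l /\ has_free_lattice_points (dilate l L) i] in
  xget 0 [set l | S l /\ lbound S l].

End convex_bodies.

(* Main.v *)
(* Choose greedily independent lattice points v_1, ..., v_n realising the minima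
   lambda_1, ..., lambda_n of the polar body; their determinant is a nonzero
   integer. For cs(K) they confine K to a parallelepiped of widths 2 lambda_i, so
   (1) follows by a linear change of variables, with equality for the cube.
   For (2) put z_i = <x, v_i> / lambda_i, so that z_i <= 1 on K. The affine function
   f = 1 + z_1 + ... + z_n has mean 1 on K because the centroid is 0, hence
   vol K is the integral of f over K, which is at most the integral of max(f, 0)
   over the whole orthant {z_i <= 1}; convexity plays no role here. Equality
   holds for the simplex {z_i <= 1, f >= 0}. For (3) take the boxes [-e, 1]^n. *)

Require Import Defs.
From HB Require Import structures.
From mathcomp Require Import all_boot all_order all_algebra perm.
From mathcomp Require Import all_classical all_reals all_analysis measurable_realfun.
From mathcomp Require Import ring lra zify.

Set Implicit Arguments.
Unset Strict Implicit.
Unset Printing Implicit Defensive.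

Import Order.TTheory GRing.Theory Num.Theory.
Import numFieldNormedType.Exports.

Local Open Scope classical_set_scope.
Local Open Scope ring_scope.

(** * Lebesgue measure under linear maps *)

Section linear_change_of_variables.
Context {R : realType}.
Local Notation lambda := (@lebesgue_measure R).

(** The measure is an iterated product over coordinates, so its behaviour under linear maps is
    derived from Fubini and a factorisation of matrices. The value of [successive_minimum] is 0 when
    no smallest factor exists; the upper bounds need genuine minima, and attainment rests on an
    inequality c|v_j| <= l for all v with <x, v> <= l on the body. In (2) only the centroid is known
    to be 0, so this inequality is itself extracted from the centroid. Sharpness uses only upper
    bounds on the minima, supplied by coordinate vectors. The constant of (2): integrating max(f, 0)
    over the orthant, one half-line at a time, gives s^(n+1)/(n+1)! at s = n+1, the largest value of
    f there. The indicator of f >= 0 gives s^n/n! instead, and the two agree at s = n+1. Hence the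
    simplex has the required volume and f has mean 1 on it, which with symmetry puts its centroid at
    0. *)

Lemma coord_le_norm n (x : 'rV[R]_n) i : `|x ord0 i| <= `|x|.
Proof.
rewrite [leRHS]/Num.norm/= mx_normrE.
exact: (@le_bigmax _ _ _ _ (fun ij : 'I_1 * 'I_n => `|x ij.1 ij.2|) (ord0, i)).
Qed.

Definition box n (A : 'I_n -> set (measurableTypeR R)) : set 'rV[R]_n :=
  [set x | forall i, A i (x ord0 i)].

Lemma measurable_box n (A : 'I_n -> set (measurableTypeR R)) :
  (forall i, measurable (A i)) -> measurable (box A).
Proof.
move=> mA; rewrite [X in measurable X](_ : _ = \bigcap_(i in [set: 'I_n])
    ((fun y : 'rV[R]_n => y ord0 i : measurableTypeR R) @^-1` A i)).
  apply: fin_bigcap_measurable => // i _; rewrite -[X in measurable X]setTI.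
  exact: measurable_coord.
by apply/seteqP; split => x /= Ax i; [move=> _|]; exact: Ax.
Qed.

Lemma lebesgue_rV_segments n (a b : 'I_n -> R) : (forall i, a i <= b i) ->
  lebesgue_rV n (box (fun i => `[a i, b i]%classic)) =
  (\prod_(i < n) (b i - a i))%:E.
Proof.
move=> ab; rewrite [LHS](@lebesgue_rV_box R n (fun i => `[a i, b i]%classic)) => [|i].
  rewrite -prodEFin; apply: eq_bigr => i _.
  rewrite lebesgue_measure_itv /= lte_fin EFinB; case: ltP => // ba.
  by rewrite (@le_anti _ _ (a i) (b i)) ?ab ?ba // -EFinB subrr.
exact: measurable_itv.
Qed.

(** Boxes, unlike the coordinate preimages that define the sigma-algebra, are closed under
    intersection, as uniqueness of measures requires. *)
Lemma sigma_algebra_box n :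
  @measurable _ 'rV[R]_n =
  <<s [set box A | A in [set A | forall i, measurable (A i)]] >>.
Proof.
apply/seteqP; split; last first.
  apply: smallest_sub; first exact: sigma_algebra_measurable.
  by move=> _ [A mA <-]; exact: measurable_box.
apply: sub_smallest2r; first exact: smallest_sigma_algebra.
rewrite -bigcup_seq => _ [i _ [B mB <-]]; rewrite setTI.
exists (fun j => if j == i then B else setT).
  by move=> j /=; case: ifP.
apply/seteqP; split => [x /(_ i)|x /= xB j]; first by rewrite eqxx.
by case: eqP => [->|].
Qed.

(** The cubes [-k, k]^n exhaust the space with finite measure, so agreement on the generating boxes
    suffices. *)
Lemma lebesgue_rV_unique n (m : {measure set 'rV[R]_n -> \bar R}) :
  (forall A, (forall i, measurable (A i)) ->
    m (box A) = (\prod_(i < n) lambda (A i))%E) ->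
  forall B, measurable B -> lebesgue_rV n B = m B.
Proof.
move=> mE.
pose I k : set R := `[- k%:R, k%:R]%classic.
have mI k : measurable (I k) by exact: measurable_itv.
pose g k : set 'rV[R]_n := box (fun=> I k).
apply: (measure_unique _ g (sigma_algebra_box n)) => [|k||_ [A mA <-]|k].
- move=> _ _ [A mA <-] [B mB <-]; exists (fun i => A i `&` B i).
    by move=> i; exact: measurableI.
  apply/seteqP; split => [x xAB|x [xA xB] i]; last by split; [exact: xA|exact: xB].
  by split => i; have [] := xAB i.
- by exists (fun=> I k) => // i; exact: mI.
- rewrite -subTset => x _; exists (Num.truncn `|x|).+1 => // i /=.
  rewrite /I /= in_itv /= -ler_norml; apply: (le_trans _ (ltW (truncnS_gt _))).
  exact: coord_le_norm.
- by rewrite mE //; exact: lebesgue_rV_box.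
- rewrite [X in (X < _)%E](_ : _ = (\prod_(i < n) (k%:R - - k%:R))%:E) ?ltry //.
  apply: (@lebesgue_rV_segments n (fun=> - k%:R) (fun=> k%:R)) => i.
  by rewrite (@le_trans _ _ 0) // oppr_le0.
Qed.

(** The image of [lambda] under x -> a x + c, scaled by |a|, has the right value on half-open
    intervals. For a < 0 the preimage is closed at the other end, which leaves its length
    unchanged. *)
Lemma lebesgue_measure_affine (a c : R) (B : set (measurableTypeR R)) : a != 0 ->
  measurable B -> lambda [set x | B (a * x + c)] = (`|a|^-1%:E * lambda B)%E.
Proof.
move=> a0 mB.
have mf : measurable_fun [set: measurableTypeR R] (fun x : measurableTypeR R => a * x + c : measurableTypeR R).
  by apply: measurable_funD => //; exact: measurable_funM.
pose m := mscale (NngNum (normr_ge0 a)) 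
  (measure_function_pushforward__canonical__measure_function_Measure lambda mf).
have mE X : m X = (`|a|%:E * lambda [set x | X (a * x + c)%R])%E by [].
suff -> : lambda B = m B by rewrite mE muleA -EFinM mulVf ?normr_eq0 // mul1e.
apply: lebesgue_measure_unique mB => _ [[l r] _ <-]; apply: etrans (esym (mE _)).
rewrite lebesgue_measure_itv /= lte_fin.
have [a_gt0|a_lt0] : 0 < a \/ a < 0 by case: (ltgtP a 0) a0; auto.
  rewrite (_ : [set x | _] = `](l - c) / a, (r - c) / a]%classic); last first.
    apply/seteqP; split => x /=; rewrite !in_itv /= ltr_pdivrMr // ler_pdivlMr //;
      by move=> ?; lra.
  rewrite lebesgue_measure_itv /= lte_fin ltr_pM2r ?invr_gt0 // ltrD2r.
  case: ifPn => _; last by rewrite mule0.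
  rewrite -!EFinB -EFinM gtr0_norm //; congr EFin; field; exact: a0.
rewrite (_ : [set x | _] = `[(r - c) / a, (l - c) / a[%classic); last first.
  apply/seteqP; split => x /=; rewrite !in_itv /= ltr_ndivlMr // ler_ndivrMr //;
    by move=> ?; lra.
rewrite lebesgue_measure_itv /= lte_fin ltr_nM2r ?invr_lt0 // ltrD2r.
case: ifPn => _; last by rewrite mule0.
rewrite -!EFinB -EFinM ltr0_norm //; congr EFin; field; exact: a0.
Qed.

Lemma measurable_mulmx n (A : 'M[R]_n) :
  measurable_fun setT (fun x : 'rV[R]_n => x *m A).
Proof.
apply: measurable_fun_coord => i; under eq_fun do rewrite mxE.
apply: measurable_sum => j; apply: measurable_funM => //.
exact: measurable_coord.
Qed.

(** The determinant is inverted because B is pulled back. The property passes to products, so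
    factors can be treated one by one. *)
Definition rescales n (A : 'M[R]_n) := forall B : set 'rV[R]_n, measurable B ->
  lebesgue_rV n [set x | B (x *m A)] = (`|\det A|^-1%:E * lebesgue_rV n B)%E.

Lemma measurable_preimage_mulmx n (A : 'M[R]_n) (B : set 'rV[R]_n) :
  measurable B -> measurable [set x : 'rV[R]_n | B (x *m A)].
Proof.
by move=> mB; rewrite -[X in measurable X]setTI; exact: measurable_mulmx.
Qed.

Lemma rescalesM n (A B : 'M[R]_n) : rescales A -> rescales B -> rescales (A *m B).
Proof.
move=> sA sB C mC; rewrite det_mulmx normrM invfM EFinM -muleA -sB //.
rewrite -sA; last exact: measurable_preimage_mulmx.
by congr (lebesgue_rV n _); apply/seteqP; split => x /=; rewrite mulmxA.
Qed.

Lemma mulmx_permE n (x : 'rV[R]_n) (s : 'S_n) i :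
  (x *m perm_mx s) ord0 (s i) = x ord0 i.
Proof.
rewrite mxE (bigD1 i) //= big1 => [|j ji]; rewrite !mxE ?eqxx ?mulr1 ?addr0 //.
by rewrite (inj_eq perm_inj) (negPf ji) mulr0.
Qed.

(** A permutation only rearranges the sides of a box, and boxes determine the measure. *)
Lemma rescales_perm n (s : 'S_n) : rescales (perm_mx s).
Proof.
move=> B mB; rewrite det_perm normr_sign invr1 mul1e.
pose m := measure_function_pushforward__canonical__measure_function_Measure
  (lebesgue_rV n) (@measurable_mulmx n (perm_mx s)).
apply/esym; apply: (@lebesgue_rV_unique n m) mB => A mA.
rewrite [LHS](_ : _ = lebesgue_rV n [set x | box A (x *m perm_mx s)]) //.
rewrite (_ : [set x | _] = box (A \o s)).
  by rewrite (reindex_perm s) /=; apply: lebesgue_rV_box => i; exact: mA.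
apply/seteqP; split => x /= xA i; first by have := xA (s i); rewrite mulmx_permE.
by rewrite -(permKV s i) mulmx_permE; exact: xA.
Qed.

(* Fubini in the first coordinate reduces this case to dimension one. *)
Lemma rescales_col0 n (E : 'M[R]_n.+1) : E ord0 ord0 != 0 ->
  (forall i j, E i (lift ord0 j) = (i == lift ord0 j)%:R) -> rescales E.
Proof.
move=> E0 Ej B mB.
have -> : \det E = E ord0 ord0.
  rewrite (expand_det_row _ ord0) big_ord_recl big1 => [|j _].
    rewrite addr0 /cofactor addn0 expr0 mul1r.
    rewrite (_ : row' _ _ = 1%:M) ?det1 ?mulr1 //.
    by apply/matrixP => i j; rewrite !mxE Ej (inj_eq lift_inj).
  by rewrite Ej mul0r.
have mB' : measurable (rV_cons (n := n) @^-1` B).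
  by rewrite -[X in measurable X]setTI; exact: measurable_rV_cons.
have mEB : measurable [set x : 'rV_n.+1 | B (x *m E)] by exact: measurable_preimage_mulmx.
have mEB' : measurable (rV_cons (n := n) @^-1` [set x : 'rV_n.+1 | B (x *m E)]).
  by rewrite -[X in measurable X]setTI; exact: measurable_rV_cons.
rewrite /= /prod_rV /pushforward.
have P2 X : measurable X -> (lambda \x lebesgue_rV n)%E X = (lambda \x^ lebesgue_rV n)%E X.
  move=> mX; apply: product_measure_unique mX => U V mU mV.
  exact: product_measure2E.
rewrite !P2 // /product_measure2 -ge0_integralZl//; last first.
  exact: measurable_fun_ysection.
apply: eq_integral => y _ /=.
(* With the tail y fixed, E acts on the first coordinate as an affine map; c collects the
   contribution of y. *)
pose c := \sum_(j < n) y ord0 j * E (lift ord0 j) ord0.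
rewrite -(lebesgue_measure_affine c) //; last exact: measurable_ysection.
have cE x : rV_cons (x, y) *m E = rV_cons (E ord0 ord0 * x + c, y).
  apply/rowP => i; rewrite mxE; case: (unliftP ord0 i) => [j|] ->.
    rewrite rV_consS (bigD1 (lift ord0 j)) //= rV_consS Ej eqxx mulr1.
    by rewrite big1 ?addr0 // => k kj; rewrite Ej (negPf kj) mulr0.
  rewrite rV_cons0 big_ord_recl rV_cons0 mulrC; congr (_ + _).
  by apply: eq_bigr => k _; rewrite rV_consS.
by congr (lambda _); apply/seteqP; split => x; rewrite /ysection /= !inE /= cE.
Qed.

(** Conjugation by the transposition of 0 and k moves the exceptional column to the front. *)
Lemma rescales_col n (E : 'M[R]_n) k : E k k != 0 ->
  (forall i j, j != k -> E i j = (i == j)%:R) -> rescales E.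
Proof.
case: n => [|n] in E k *; first by case: k.
move=> Ek Ej; pose P : 'M[R]_n.+1 := perm_mx (tperm ord0 k).
have PE : P *m P = 1%:M by rewrite -perm_mxM tperm2 perm_mx1.
have -> : E = P *m (P *m E *m P) *m P by rewrite !mulmxA PE mul1mx -mulmxA PE mulmx1.
apply: rescalesM; last exact: rescales_perm.
apply: rescalesM; first exact: rescales_perm.
have PEP i j : (P *m E *m P) i j = E (tperm ord0 k i) (tperm ord0 k j).
  have -> : P *m E = row_perm (tperm ord0 k) E by rewrite row_permE.
  have -> : forall A : 'M[R]_n.+1, A *m P = col_perm (tperm ord0 k) A.
    by move=> A; rewrite col_permE /P -[in RHS](tpermV ord0 k) invgK.
  by rewrite !mxE.
apply: rescales_col0 => [|i j]; first by rewrite PEP tpermL.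
rewrite PEP Ej ?(inj_eq perm_inj) //.
by rewrite -[X in _ != X](tpermL ord0 k) (inj_eq perm_inj).
Qed.

Lemma rescales1 n : rescales (1%:M : 'M[R]_n).
Proof.
move=> B mB; rewrite det1 normr1 invr1 mul1e.
by congr (lebesgue_rV n _); apply/seteqP; split => x /=; rewrite mulmx1.
Qed.

(* Columns of [A] that are not unit vectors are exchanged for unit vectors one
   at a time, as in Steinitz's lemma: [s] lists the columns still to be treated. *)
Lemma rescales_unitmx_rec n (s : seq 'I_n) (A : 'M[R]_n) : A \in unitmx ->
  (forall i j, j \notin s -> A i j = (i == j)%:R) -> rescales A.
Proof.
elim: s A => [|k s IHs] A uA sA.
  have -> : A = 1%:M by apply/matrixP => i j; rewrite sA // mxE.
  exact: rescales1.
(* A nonzero cofactor in column k: the unit vector e_j may replace that column without loss of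
   invertibility. *)
have [j cj] : exists j, cofactor A j k != 0.
  apply/existsP; apply: contraLR uA => /existsPn c0.
  rewrite unitmxE unitfE negbK (expand_det_col _ k) big1 // => j _.
  by have := c0 j; rewrite negbK => /eqP ->; rewrite mulr0.
pose A' : 'M[R]_n := \matrix_(i, l) if l == k then (i == j)%:R else A i l.
have dA' : \det A' = cofactor A j k.
  rewrite (expand_det_col _ k) (bigD1 j) //= big1 => [|i ij].
    rewrite !mxE !eqxx mul1r addr0; congr (_ * \det _).
    by apply/matrixP => a b; rewrite !mxE eq_sym (negPf (neq_lift _ _)).
  by rewrite !mxE eqxx (negPf ij) mul0r.
have uA' : A' \in unitmx by rewrite unitmxE unitfE dA'.
pose E := invmx A' *m A.
have AE : A = A' *m E by rewrite mulmxA mulmxV // mul1mx.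
have Ej i l : l != k -> E i l = (i == l)%:R.
  move=> lk; have -> : E i l = (invmx A' *m A') i l.
    by rewrite !mxE; apply: eq_bigr => m _; rewrite !mxE (negPf lk).
  by rewrite mulVmx // mxE.
have Ek : E k k != 0.
  have : \det E != 0.
    by rewrite -unitfE -unitmxE unitmx_mul unitmx_inv uA' uA.
  apply: contra => /eqP Ek0; rewrite (expand_det_row _ k) big1 // => l _.
  have [->|lk] := eqVneq l k; first by rewrite Ek0 mul0r.
  by rewrite Ej // eq_sym (negPf lk) mul0r.
(* Otherwise column j is already e_j, and [A'] would have two equal columns. *)
have js : j \in k :: s.
  apply: contraT => js; have jk : j != k by move: js; rewrite inE negb_or => /andP[].
  move: uA'; rewrite unitmxE unitfE => /negP[]; apply/eqP.
  rewrite -det_tr; apply: (determinant_alternate jk) => l.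
  by rewrite !mxE eqxx (negPf jk) sA.
rewrite AE; apply: rescalesM; last exact: rescales_col Ek Ej.
(* Swapping rows j and k turns the new column e_j into e_k and fixes the unit columns outside
   [k :: s]. *)
pose P : 'M[R]_n := perm_mx (tperm j k).
have PE : P *m P = 1%:M by rewrite -perm_mxM tperm2 perm_mx1.
have -> : A' = P *m (P *m A') by rewrite mulmxA PE mul1mx.
apply: rescalesM; first exact: rescales_perm.
apply: IHs => [|i l ls]; first by rewrite unitmx_mul uA' unitmx_perm.
rewrite -row_permE !mxE; case: (eqVneq l k) => [->|lk].
  by rewrite -[X in _ == X](tpermR j k) (inj_eq perm_inj).
have lks : l \notin k :: s by rewrite inE negb_or lk.
rewrite sA // -[X in _ == X](tpermD (z := l) (x := j) (y := k)) ?(inj_eq perm_inj) //.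
  by apply: contraNneq lks => <-.
by rewrite eq_sym.
Qed.

Lemma lebesgue_rV_mulmx n (A : 'M[R]_n) (B : set 'rV[R]_n) : A \in unitmx ->
  measurable B ->
  lebesgue_rV n [set x | B (x *m A)] = (`|\det A|^-1%:E * lebesgue_rV n B)%E.
Proof.
by move=> uA; apply: (@rescales_unitmx_rec _ (enum 'I_n)) => // i j; rewrite mem_enum.
Qed.

End linear_change_of_variables.

(** * Measurability of open and compact sets *)

Section closed_sets_are_measurable.
Context {R : realType}.

(** An open set is the countable union of the open cubes with rational centre and radius 1/(m+1)
    that it contains. *)
Lemma open_measurable_rV n (U : set 'rV[R]_n) : open U -> measurable U.
Proof.
move=> oU.
pose Q (p : nat * 'rV[rat]_n) : set 'rV[R]_n :=
  box (fun i => `](ratr (p.2 ord0 i) - p.1.+1%:R^-1), (ratr (p.2 ord0 i) + p.1.+1%:R^-1)[%classic).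
rewrite (_ : U = \bigcup_(p in [set p | Q p `<=` U]) Q p).
  rewrite bigcup_mkcond; apply: countable_bigcupT_measurable.
    exact: countableP.
  move=> p; case: ifP => // _; apply: measurable_box => i; exact: measurable_itv.
apply/seteqP; split => [x Ux|x [p pU]]; last exact: pU.
have /nbhs_ballP[e /= e0 xeU] : nbhs x U by exact: open_nbhs_nbhs.
(* Twice the radius 1/(k+1) is below e, so a cube whose centre is within that radius of x contains x
   and stays in the e-ball. *)
pose k := Num.truncn (2 / e).
have k0 : (0 : R) < k.+1%:R^-1 by rewrite invr_gt0.
have ke : 2 * k.+1%:R^-1 < e.
  by rewrite ltr_pdivrMr // mulrC -ltr_pdivrMr // truncnS_gt.
have [d Ed] : exists d : R, d = k.+1%:R^-1 by eexists.
rewrite -Ed in k0 ke.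
have /choice[q xq] : forall i, exists q : rat,
    ratr q \in `](x ord0 i - d), (x ord0 i + d)[.
  by move=> i; have [|q] := @rat_in_itvoo R (x ord0 i - d) (x ord0 i + d); [lra|exists q].
exists (k, \row_i q i) => /= [y yQ|i /=]; last first.
  by rewrite in_itv /= mxE -Ed; have := xq i; rewrite in_itv /= => ?; lra.
apply: xeU; split => // i j; rewrite (ord1 i) /ball /=.
have := xq j; have := yQ j; rewrite /= !in_itv /= mxE -Ed => ? ?.
by rewrite ltr_norml; lra.
Qed.

Lemma compact_measurable_rV n (K : set 'rV[R]_n) : compact K -> measurable K.
Proof.
move=> /compact_closed => /(_ (@norm_hausdorff _ _)) cK.
by rewrite -[K]setCK; apply: measurableC; apply: open_measurable_rV; exact: closed_openC.
Qed.

End closed_sets_are_measurable.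

(** * Truncated powers on the line *)

Section ramp.
Context {R : realType}.
Local Notation mu := (@lebesgue_measure R).

(* s_+^k / k!, where for k = 0 this is the indicator of s >= 0; integrating over
   a half-line raises k by one, which makes the induction on n go through. *)
Definition ramp k (s : R) : R := if 0 <= s then s ^+ k / k`!%:R else 0.

Lemma ramp_ge0 k s : 0 <= ramp k s.
Proof. by rewrite /ramp; case: ifP => // s0; rewrite divr_ge0 ?exprn_ge0. Qed.

Lemma measurable_ramp k : measurable_fun [set: R] (ramp k).
Proof.
apply: measurable_fun_ifT => //; first exact: measurable_realfun.measurable_fun_ler.
by apply: measurable_funM => //; exact: measurable_realfun.exprn_measurable.
Qed.

(** On [-t, 1] the integrand has the primitive (t + z)^(k+1)/(k+1)!, and below -t it vanishes. If -t
    >= 1, at most the null set z = 1 contributes. *)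
Lemma integral_ramp k (t : R) :
  (\int[mu]_(z in `]-oo, 1%R]) (ramp k (t + z))%:E = (ramp k.+1 (t + 1))%:E)%E.
Proof.
pose f z : R := (t + z) ^+ k / k`!%:R.
pose F z : R := (t + z) ^+ k.+1 / k.+1`!%:R.
have kn0 m : m`!%:R != 0 :> R by rewrite pnatr_eq0 -lt0n fact_gt0.
have dF z : is_derive z (1 : R) F (f z).
  have -> : F = k.+1`!%:R^-1 *: (cst t + id : R -> R) ^+ k.+1.
    by apply/funext => x; rewrite /F mulrC exprfctE.
  have -> : f z = k.+1`!%:R^-1 *: ((k.+1%:R * (cst t + id : R -> R) z ^+ k.+1.-1) *: (0 + 1 : R)).
    rewrite /f factS natrM /= add0r /GRing.scale /= mulr1 [(cst t + id) z]/(t + z).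
    by rewrite invfM -mulrA [X in _ = _ * X]mulrCA mulKf ?pnatr_eq0 // mulrC.
  have d0 : is_derive z (1 : R) (cst t + id : R -> R) (0 + 1).
    exact: (is_deriveD (is_derive_cst _ _ _) (is_derive_id _ _)).
  exact: (is_deriveZ _ (is_deriveX _ d0)).
have cF z : {for z, continuous F} by apply: differentiable_continuous; apply/derivable1_diffP; exact: ex_derive.
have cf z : {for z, continuous f}.
  apply: cvgM; last exact: cvg_cst.
  apply: (@continuous_comp _ _ _ (fun z : R => t + z) (fun y : R => y ^+ k)).
    by apply: cvgD; [exact: cvg_cst|exact: cvg_id].
  exact: exprn_continuous.
have [t1|t1] := ltP (- t) 1.
  transitivity (\int[mu]_(z in `[(- t)%R, 1%R]) (f z)%:E)%E.
    rewrite [RHS]integral_mkcond [LHS]integral_mkcond; apply: eq_integral => z _.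
    rewrite /patch !mem_setE !in_itv /= /ramp.
    case: (leP z 1) => z1; rewrite ?andbF ?andbT //.
    by rewrite -lerBlDl sub0r; case: ifP.
  rewrite (continuous_FTC2 (F := F) t1).
  - rewrite /F subrr expr0n /= mul0r sube0 /ramp ifT //; lra.
  - by apply: continuous_subspaceT => z; exact: cf.
  - split; [by move=> x _; exact: ex_derive|..].
      by apply: cvg_at_right_filter; exact: cF.
    by apply: cvg_at_left_filter; exact: cF.
  - by move=> z _; rewrite derive1E derive_val.
rewrite (_ : ramp k.+1 (t + 1) = 0); last first.
  rewrite /ramp; case: ifP => // h; have -> : t + 1 = 0 by lra.
  by rewrite expr0n mul0r.
transitivity (\int[mu]_(z in [set 1%R]) (ramp k (t + z))%:E)%E; last exact: integral_set1.
rewrite [RHS]integral_mkcond [LHS]integral_mkcond; apply: eq_integral => z _.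
rewrite /patch !mem_setE in_itv /= in_set1 /ramp.
by case: (ltgtP z 1) => // z1; rewrite leNgt (_ : t + z < 0) //; lra.
Qed.
(** Cancelling one factor n+1 in (n+1)^(n+1)/(n+1)! yields the sharp constant. *)
Lemma ramp_succ n : ramp n.+1 (1 + n%:R) = n.+1%:R ^+ n / n`!%:R.
Proof.
by rewrite /ramp addrC natr1 ler0n exprS factS natrM -mulf_div divff ?mul1r //.
Qed.

End ramp.

(** * Integration over R^n *)

Section integrals_over_rV.
Context {R : realType}.
Local Open Scope ereal_scope.

Lemma integral_rV_mulmx n (A : 'M[R]_n) (g : 'rV[R]_n -> \bar R) : A \in unitmx ->
  measurable_fun setT g -> (forall x, 0 <= g x) ->
  \int[lebesgue_rV n]_x g (x *m A) = `|\det A|^-1%:E * \int[lebesgue_rV n]_x g x.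
Proof.
move=> uA mg g0.
have dA : (0 <= `|\det A|^-1)%R by rewrite invr_ge0.
rewrite -(@ge0_integral_mscale _ _ _ (lebesgue_rV n) _ measurableT (NngNum dA)) //.
rewrite -[LHS](@ge0_integral_pushforward _ _ _ _ _ (fun x : 'rV[R]_n => x *m A)
  (measurable_mulmx A) (lebesgue_rV n) setT g) //.
apply: (@eq_measure_integral _ _ _ _ (mscale (NngNum dA) (lebesgue_rV n))
  (measure_function_pushforward__canonical__measure_function_Measure
    (lebesgue_rV n) (measurable_mulmx A))) => B mB _.
exact: lebesgue_rV_mulmx.
Qed.

Lemma integral_rV_cons n (g : 'rV[R]_n.+1 -> \bar R) :
  measurable_fun setT g -> (forall x, 0 <= g x) ->
  \int[lebesgue_rV n.+1]_x g x =
  \int[lebesgue_rV n]_y \int[lebesgue_measure]_x g (rV_cons (x, y)).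
Proof.
move=> mg g0.
transitivity (\int[lebesgue_measure \x lebesgue_rV n]_p g (rV_cons p)).
  rewrite /= /prod_rV.
  rewrite -[RHS](@ge0_integral_pushforward _ _ _ _ _ (@rV_cons R n)
    (@measurable_rV_cons R n) (lebesgue_measure \x lebesgue_rV n) setT g) //.
rewrite fubini_tonelli2 //.
by apply: measurableT_comp => //; exact: measurable_rV_cons.
Qed.

Definition orthant n : set 'rV[R]_n := box (fun=> `]-oo, 1%R]%classic).

Lemma measurable_orthant n : measurable (@orthant n).
Proof. by apply: measurable_box => _; exact: measurable_itv. Qed.

Lemma measurable_ramp_sum n k (t : R) :
  measurable_fun setT (fun x : 'rV[R]_n => ramp k (t + \sum_i x ord0 i)).
Proof.
apply: (measurableT_comp (@measurable_ramp R k)).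
apply: measurable_funD => //; apply: measurable_sum => i; exact: measurable_coord.
Qed.

(** Each coordinate runs over a half-line ending at 1, which raises both the order and the argument
    by 1; the induction hypothesis is used with [k.+1] and [t + 1]. *)
Lemma integral_ramp_orthant n k (t : R) :
  \int[lebesgue_rV n]_(x in @orthant n) (ramp k (t + \sum_i x ord0 i))%:E =
  (ramp (n + k) (t + n%:R))%:E.
Proof.
elim: n k t => [|n IHn] k t.
  rewrite integral_dirac //; [|exact: measurable_orthant|].
    by rewrite diracE mem_set ?mul1e ?big_ord0 // => -[].
  apply/measurable_EFinP; apply: measurable_funTS; exact: measurable_ramp_sum.
rewrite integral_mkcond integral_rV_cons; first last.
- by move=> x; rewrite /patch; case: ifP => // _; rewrite lee_fin ramp_ge0.
- apply/(measurable_restrictT _ _).1; first exact: measurable_orthant.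
  apply/measurable_EFinP; apply: measurable_funTS; exact: measurable_ramp_sum.
rewrite addSnnS -natr1 addrA addrAC -IHn [RHS]integral_mkcond.
apply: eq_integral => y _; rewrite {2}/patch.
have mem_cons x : (rV_cons (x, y) \in @orthant n.+1) = (x <= 1)%R && (y \in @orthant n).
  apply/idP/idP => [|/andP[x1]]; rewrite !inE => H.
    apply/andP; split; first by have := H ord0; rewrite rV_cons0 /= in_itv.
    by rewrite inE => i; have := H (lift ord0 i); rewrite rV_consS.
  move=> i; case: (unliftP ord0 i) => [j|] ->; first by rewrite rV_consS; exact: H.
  by rewrite rV_cons0 /= in_itv.
case: ifPn => [yO|/negPf yO]; last first.
  by rewrite integral0_eq // => x _; rewrite /patch mem_cons yO andbF.
rewrite -addrA [(1 + _)%R]addrC addrA -integral_ramp [RHS]integral_mkcond.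
apply: eq_integral => x _; rewrite /patch mem_cons yO andbT mem_setE in_itv /=.
case: ifP => // _; rewrite big_ord_recl rV_cons0 /=; congr (ramp _ _)%:E.
rewrite addrA addrAC; congr (_ + _ + _)%R.
by apply: eq_bigr => i _; rewrite rV_consS.
Qed.

End integrals_over_rV.

(** * Successive minima of polar sets *)

Section successive_minima.
Context {R : realType} {n : nat}.
Implicit Types (K : set 'rV[R]_n).

(** Support-function form, for l > 0, of the rows of [Z] lying in l times the polar; it keeps
    dilations out of the arguments. *)
Definition admissible K i (Z : 'M[int]_(i, n)) (l : R) :=
  forall j x, K x -> \sum_k x ord0 k * (Z j k)%:~R <= l.

Lemma dilate_polarE K i (Z : 'M[int]_(i, n)) l : 0 < l ->
  (forall j, dilate l (polar K) (row j (map_mx intr Z))) <-> admissible K Z l.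
Proof.
move=> l0; split => [H j x Kx|H j].
  have [y yK /rowP yE] := H j.
  rewrite (eq_bigr (fun k => l * (x ord0 k * y ord0 k))) => [|k _].
    by rewrite -mulr_sumr -[leRHS]mulr1 ler_pM2l // yK.
  by have := yE k; rewrite !mxE => <-; rewrite mulrCA.
exists (l^-1 *: row j (map_mx intr Z)); last by rewrite scalerA divff ?gt_eqF // scale1r.
move=> x Kx; rewrite (eq_bigr (fun k => l^-1 * (x ord0 k * (Z j k)%:~R))) => [|k _].
  by rewrite -mulr_sumr mulrC ler_pdivrMr // mul1r H.
by rewrite !mxE mulrCA.
Qed.

Lemma successive_minimum_ge0 K i : 0 <= successive_minimum (polar K) i.
Proof. by rewrite /successive_minimum; case: xgetP => // l _ [[/ltW]]. Qed.

(* Also true when the minimum is not attained: its junk value is then 0. *)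
Lemma successive_minimum_le K i (Z : 'M[int]_(i, n)) l : 0 < l ->
  row_free (map_mx intr Z : 'M[R]_(i, n)) -> admissible K Z l ->
  successive_minimum (polar K) i <= l.
Proof.
move=> l0 fZ Zl; rewrite /successive_minimum; case: xgetP => [m _ [_ Sm]|_]; last exact: ltW.
by apply: Sm; split => //; exists Z; split => //; apply/dilate_polarE.
Qed.

Definition diag_lattice i : 'M[int]_(i, n) := \matrix_(a, b) (val a == val b)%:R.

Lemma diag_lattice_free i : (i <= n)%N -> row_free (map_mx intr (diag_lattice i) : 'M[R]_(i, n)).
Proof.
move=> le_in; rewrite (_ : map_mx _ _ = pid_mx i); first by rewrite /row_free rank_pid_mx // leqnn.
by apply/matrixP => a b; rewrite !mxE ltn_ord andbT; case: eqP.
Qed.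

Lemma sum_diag_lattice i (x : 'rV[R]_n) (j : 'I_i) (le_in : (i <= n)%N) :
  \sum_k x ord0 k * (diag_lattice i j k)%:~R = x ord0 (widen_ord le_in j).
Proof.
rewrite (bigD1 (widen_ord le_in j)) //= mxE eqxx mulr1 big1 ?addr0 // => k kj.
by rewrite mxE [_ == _](_ : _ = false) ?mulr0 //; apply: contraNF kj => /eqP jk; apply/eqP/val_inj.
Qed.

Lemma successive_minimum_le_coord K i l : 0 < l -> (i <= n)%N ->
  (forall x, K x -> forall j, x ord0 j <= l) -> successive_minimum (polar K) i <= l.
Proof.
move=> l0 le_in Kl; apply: (successive_minimum_le l0 (diag_lattice_free le_in)) => j x Kx.
by rewrite sum_diag_lattice Kl.
Qed.

(** The negated unit vectors bring the minima of the boxes [-e, 1]^n down to e, where the unit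
    vectors themselves only give 1. *)
Lemma successive_minimum_le_opp_coord K i l : 0 < l -> (i <= n)%N ->
  (forall x, K x -> forall j, - x ord0 j <= l) -> successive_minimum (polar K) i <= l.
Proof.
move=> l0 le_in Kl; apply: (@successive_minimum_le _ _ (- diag_lattice i)) => //.
  rewrite map_mxN /row_free mxrank_opp; exact: diag_lattice_free.
move=> j x Kx; rewrite (eq_bigr (fun k => - (x ord0 k * (diag_lattice i j k)%:~R))) => [|k _].
  by rewrite sumrN sum_diag_lattice Kl.
by rewrite !mxE mulrNz mulrN.
Qed.

(** * Attained minima and independent vectors realising them *)

Section attained.
Variables (K : set 'rV[R]_n) (B c : R).
Hypotheses (KB : forall x, K x -> forall j, x ord0 j <= B) (c0 : 0 < c).
(* Says that the polar of K is bounded, i.e. that 0 is interior to the convex hull of K. *)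
Hypothesis Kc : forall (v : 'rV[R]_n) l, (forall x, K x -> \sum_k x ord0 k * v ord0 k <= l) ->
  forall j, c * `|v ord0 j| <= l.

Let S i := [set l : R | 0 < l /\ has_free_lattice_points (dilate l (polar K)) i].

Let SE i l : S i l <-> 0 < l /\ exists2 Z : 'M[int]_(i, n),
  row_free (map_mx intr Z : 'M[R]_(i, n)) & admissible K Z l.
Proof.
split => [[l0 [Z [fZ]]]|[l0 [Z fZ ZK]]].
  by move/(dilate_polarE _ _ l0) => ZK; split=> //; exists Z.
by split=> //; exists Z; split=> //; apply/dilate_polarE.
Qed.

Let admissible_entry i (Z : 'M[int]_(i, n)) l j k : admissible K Z l -> c * `|(Z j k)%:~R| <= l.
Proof.
move=> ZK; have := @Kc (row j (map_mx intr Z)) l _ k.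
rewrite !mxE; apply => x Kx; rewrite (eq_bigr (fun k => x ord0 k * (Z j k)%:~R)) ?ZK // => m _.
by rewrite !mxE.
Qed.

(** A nonzero integer row has an entry of absolute value at least 1, which [Kc] turns into a lower
    bound on l. Hence the infimum is positive. *)
Let S_ge i l : (0 < i)%N -> S i l -> c <= l.
Proof.
case: i => // i _ /SE[l0 [Z fZ ZK]].
have [k Zk] : exists k, Z ord0 k != 0.
  apply/existsP; apply: contraLR fZ => /existsPn Z0.
  suff: row ord0 (map_mx intr Z : 'M[R]_(i.+1, n)) = 0.
    move=> r0; rewrite -kermx_eq0; apply/rowV0Pn; exists (delta_mx ord0 ord0).
      by apply/sub_kermxP; rewrite -rowE.
    by apply/eqP => /rowP /(_ ord0) /eqP; rewrite !mxE !eqxx oner_eq0.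
  by apply/rowP => k; rewrite !mxE; have := Z0 k; rewrite negbK => /eqP ->.
apply: le_trans (admissible_entry ord0 k ZK).
rewrite -[leLHS]mulr1 ler_pM2l // -intr_norm -[1]/(1%:~R) ler_int.
by rewrite -gtz0_ge1 normr_gt0.
Qed.

Lemma successive_minimum_attained i : (0 < i <= n)%N ->
  let l := successive_minimum (polar K) i in
  0 < l /\ exists2 Z : 'M[int]_(i, n),
    row_free (map_mx intr Z : 'M[R]_(i, n)) & admissible K Z l.
Proof.
move=> /andP[i0 le_in] /=.
have S0 : S i !=set0.
  (* Unit vectors are admissible at |B|; adding 1 makes the value positive. *)
  exists (`|B| + 1); apply/SE; split; first by rewrite ltr_wpDl.
  exists (diag_lattice i) => [|j x Kx]; first exact: diag_lattice_free.
  by rewrite sum_diag_lattice (le_trans (KB Kx _)) // (le_trans (ler_norm _)) // lerDl.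
have lbS : lbound (S i) c by move=> l Sl; exact: S_ge Sl.
have hS : has_inf (S i) by split => //; exists c.
pose m := inf (S i).
have cm : c <= m by exact: lb_le_inf.
have m0 : 0 < m by exact: lt_le_trans cm.
(* Once the infimum lies in the set, it is what [xget] returns, not the default 0. *)
suff Sm : S i m.
  have -> : successive_minimum (polar K) i = m.
    rewrite /successive_minimum; case: xgetP => [l _ [Sl lbl]|/(_ m) H].
      by apply/eqP; rewrite eq_le lbl // ge_inf //; exists c.
    by exfalso; apply: H; split=> // l Sl; apply: ge_inf => //; exists c.
  exact/SE.
apply: contrapT => Sm.
(* Matrices admissible near the infimum m have bounded entries, so there are only
   finitely many, and each one not admissible at m fails up to some m + e > m. *)
pose N := (Num.truncn ((m + 1) / c)).+1.
(* Entries in [-N, N] are shifted by N into ordinals, so that the candidate matrices form a finite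
   type. *)
pose T := 'M['I_(N + N).+1]_(i, n).
pose dec (W : T) : 'M[int]_(i, n) := \matrix_(a, b) ((W a b : nat)%:Z - N%:Z).
have bad (W : T) : exists e : R, 0 < e /\
    (row_free (map_mx intr (dec W) : 'M[R]_(i, n)) -> ~ admissible K (dec W) (m + e)).
  have [fW|fW] := boolP (row_free (map_mx intr (dec W) : 'M[R]_(i, n))); last by exists 1.
  have : ~ admissible K (dec W) m by move=> aW; apply: Sm; apply/SE; split => //; exists (dec W).
  move=> /existsNP[j /existsNP[x /not_implyP[Kx /negP]]]; rewrite -ltNge => lt.
  set s := (X in m < X) in lt.
  exists ((s - m) / 2); split => [|_ /(_ j x Kx)]; first by rewrite divr_gt0 ?subr_gt0.
  by rewrite -/s leNgt (_ : _ < s) //; lra.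
have /choice[e eP] := bad.
(* The initial value 1 keeps d <= 1, so N bounds the entries of every matrix admissible below m +
   d. *)
pose d := \big[Num.min/1]_(W : T) e W.
have d0 : 0 < d.
  rewrite /d; elim/big_ind : _ => // [a b a0 b0|W _]; first by rewrite lt_min a0.
  by have [] := eP W.
have [l Sl lm] := inf_adherent d0 hS.
have /SE[l0 [Z fZ ZK]] := Sl.
have Zle a b : (`|Z a b| <= N)%N.
  rewrite -(ler_nat R) natr_absz intr_norm; apply: le_trans (ltW (truncnS_gt _)).
  rewrite ler_pdivlMr // mulrC (le_trans (admissible_entry a b ZK)) //.
  by rewrite (le_trans (ltW lm)) // lerD2l; exact: bigmin_le_id.
pose W : T := \matrix_(a, b) inord `|Z a b + N%:Z|.
have WZ : dec W = Z.
  apply/matrixP => a b; rewrite !mxE inordK; have := Zle a b; lia.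
have [_ H] := eP W; rewrite WZ in H; apply: H => // j x Kx.
apply: le_trans (ZK j x Kx) _; apply: le_trans (ltW lm) _.
by rewrite lerD2l; exact: bigmin_le.
Qed.

(* Greedy choice: among i + 1 independent vectors, one is not in the span of the
   i vectors already chosen. *)
Lemma successive_minima_basis : exists V : 'M[int]_n,
  \det V != 0 /\ forall (i : 'I_n) x, K x ->
    \sum_k x ord0 k * (V i k)%:~R <= successive_minimum (polar K) i.+1.
Proof.
(* An infinite sequence holds the vectors, so that adding one does not change their type. *)
pose M k (V : nat -> 'rV[int]_n) : 'M[R]_(k, n) := \matrix_(i, j) (V i ord0 j)%:~R.
have [V fV VK] : exists2 V : nat -> 'rV[int]_n, row_free (M n V) &
    forall i, (i < n)%N -> forall x, K x ->
    \sum_j x ord0 j * (V i ord0 j)%:~R <= successive_minimum (polar K) i.+1.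
  suff: forall k, (k <= n)%N -> exists2 V : nat -> 'rV[int]_n, row_free (M k V) &
    forall i, (i < k)%N -> forall x, K x ->
    \sum_j x ord0 j * (V i ord0 j)%:~R <= successive_minimum (polar K) i.+1.
    exact.
  elim=> [|k IHk] lt_kn.
    by exists (fun=> 0) => //; rewrite /row_free flatmx0 mxrank0.
  have [V /eqP fV VK] := IHk (ltnW lt_kn).
  have [_ [Z /eqP fZ ZK]] := @successive_minimum_attained k.+1 lt_kn.
  have [j jV] : exists j, ~~ (row j (map_mx intr Z) <= M k V)%MS.
    apply/existsP; rewrite -negb_forall; apply/negP => /forallP /row_subP /mxrankS.
    by rewrite fZ fV ltnn.
  pose V' i := if i == k then row j Z else V i.
  have MV : M k V' = M k V.
    by apply/matrixP => a b; rewrite !mxE /V' ltn_eqF.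
  exists V' => [|i lt_ik x Kx]; last first.
    rewrite /V'; case: eqVneq => [->|ik]; last by apply: VK => //; rewrite ltn_neqAle ik -ltnS.
    by apply: le_trans (ZK j x Kx); rewrite le_eqVlt; apply/orP; left; apply/eqP/eq_bigr => m _; rewrite !mxE.
  rewrite /row_free eqn_leq rank_leq_row /= -{1}fV -MV.
  suff: (M k V' < M k.+1 V')%MS by rewrite ltmxErank => /andP[].
  rewrite ltmxE; apply/andP; split.
    apply/row_subP => i; apply: (eq_row_sub (widen_ord (leqnSn k) i)).
    by apply/rowP => m; rewrite !mxE.
  apply: contra jV; rewrite MV; apply: submx_trans.
  apply: (eq_row_sub (ord_max : 'I_k.+1)).
  by apply/rowP => m; rewrite !mxE /V' eqxx !mxE.
exists (\matrix_(i, j) V i ord0 j); split => [|i x Kx]; last first.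
  apply: le_trans (VK i (ltn_ord i) x Kx).
  by rewrite le_eqVlt; apply/orP; left; apply/eqP/eq_bigr => m _; rewrite mxE.
rewrite -(intr_eq0 R) -det_map_mx.
rewrite (_ : map_mx _ _ = M n V); last by apply/matrixP => a b; rewrite !mxE.
by move: fV; rewrite row_free_unit unitmxE unitfE.
Qed.

End attained.
End successive_minima.

(** * Volume, centroid and support bounds *)

Section bodies.
Context {R : realType} {n : nat}.
Implicit Types (K : set 'rV[R]_n) (v : 'rV[R]_n).
Local Notation mu := (@lebesgue_rV R n).

Lemma sum_delta (a : R) j v :
  \sum_k (a *: delta_mx ord0 j : 'rV[R]_n) ord0 k * v ord0 k = a * v ord0 j.
Proof.
rewrite (bigD1 j) //= big1 ?addr0 => [|k kj]; first by rewrite !mxE !eqxx mulr1.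
by rewrite !mxE (negPf kj) andbF mulr0 mul0r.
Qed.

(** With s = v_j this displacement stays within a cube of half-width e and raises <x, v> by
    e|v_j|. *)
Lemma normr_sg_delta_le (e s : R) j k : 0 <= e ->
  `|((e * Num.sg s) *: delta_mx ord0 j : 'rV[R]_n) ord0 k| <= e.
Proof.
move=> e0; rewrite !mxE eqxx /= !normrM normr_nat (ger0_norm e0) -mulrA ler_piMr //.
by rewrite normr_sg -natrM lern1; case: (k == j); case: (s != 0).
Qed.

Lemma compact_coord_bounded K : compact K -> exists2 M : R, 0 < M &
  forall x, K x -> forall j, `|x ord0 j| <= M.
Proof.
move=> /compact_bounded[M [_ KM]]; exists (`|M| + 1); first by rewrite ltr_wpDl.
move=> x Kx j; apply: le_trans (coord_le_norm x j) _; apply: KM => //.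
by rewrite (le_lt_trans (ler_norm M)) // ltrDl.
Qed.

Lemma interior_segments K x0 : interior K x0 -> exists2 e : R, 0 < e &
  forall y : 'rV[R]_n, (forall j, `|y ord0 j - x0 ord0 j| <= e) -> K y.
Proof.
move=> /nbhs_ballP[e /= e0 eK]; exists (e / 2); first by rewrite divr_gt0.
move=> y ye; apply: eK; split => // i j; rewrite (ord1 i) /ball /= distrC.
by apply: le_lt_trans (ye j) _; rewrite ltr_pdivrMr // ltr_pMr // ltr1n.
Qed.

Lemma lebesgue_rV_cube (x0 : 'rV[R]_n) (e : R) : 0 <= e ->
  mu (box (fun j => `[(x0 ord0 j - e), (x0 ord0 j + e)]%classic)) = ((e *+ 2) ^+ n)%:E.
Proof.
move=> e0; rewrite lebesgue_rV_segments => [|j]; last by rewrite lerD2l ge0_cp.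
rewrite (eq_bigr (fun=> e *+ 2)) => [|j _]; first by rewrite prodr_const card_ord.
by rewrite mulr2n; ring.
Qed.

Lemma vol_lty K : compact K -> (mu K < +oo)%E.
Proof.
move=> cK; have [M M0 KM] := compact_coord_bounded cK.
pose C := box (fun j : 'I_n => `[((0 : 'rV[R]_n) ord0 j - M), ((0 : 'rV[R]_n) ord0 j + M)]%classic).
apply: (@le_lt_trans _ _ (mu C)); last first.
  by rewrite [X in (X < _)%E](@lebesgue_rV_cube 0 M (ltW M0)) ltry.
apply: le_measure; rewrite ?inE; [exact: compact_measurable_rV| |].
  by apply: measurable_box => j; exact: measurable_itv.
by move=> x Kx j /=; rewrite in_itv /= mxE sub0r add0r -ler_norml KM.
Qed.

Lemma vol_gt0 K : convex_body K -> (0 < mu K)%E.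
Proof.
move=> [cK _ [x0 /interior_segments[e e0 eK]]].
pose C := box (fun j : 'I_n => `[(x0 ord0 j - e), (x0 ord0 j + e)]%classic).
apply: (@lt_le_trans _ _ (mu C)).
  by rewrite [X in (_ < X)%E](@lebesgue_rV_cube x0 e (ltW e0)) lte_fin exprn_gt0 // mulrn_wgt0.
apply: le_measure; rewrite ?inE; [|exact: compact_measurable_rV|].
  by apply: measurable_box => j; exact: measurable_itv.
by move=> x xC; apply: eK => j; have := xC j; rewrite /= in_itv /= ler_distl.
Qed.

Lemma vol_fin_num K : compact K -> mu K \is a fin_num.
Proof. by move=> cK; rewrite ge0_fin_numE ?vol_lty. Qed.

Lemma integrable_coord K j : compact K ->
  mu.-integrable K (fun x => (x ord0 j)%:E).
Proof.
move=> cK; have [M M0 KM] := compact_coord_bounded cK.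
apply: measurable_bounded_integrable; first exact: compact_measurable_rV.
- exact: vol_lty.
- by apply: measurable_funTS; exact: measurable_coord.
- exists M; split; first exact: num_real.
  by move=> y My x Kx /=; apply: le_trans (ltW My); exact: KM.
Qed.

Lemma centroid_dot K v : convex_body K -> centroid K = 0 ->
  (\int[mu]_(x in K) (\sum_k x ord0 k * v ord0 k)%:E = 0)%E.
Proof.
move=> bK c0; have [cK _ _] := bK; have mK := compact_measurable_rV cK.
have K0 j : (\int[mu]_(x in K) (x ord0 j)%:E = 0)%E.
  (* The quotient by the volume vanishes only with its numerator, since the volume is positive and
     finite. *)
  move/rowP: c0 => /(_ j); rewrite !mxE => /eqP; rewrite mulf_eq0 invr_eq0.
  have -> : (fine (vol K) == 0) = false.
    by rewrite gt_eqF // fine_gt0 // vol_gt0 //= vol_lty.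
  rewrite orbF /Rintegral => /eqP fI.
  by rewrite -[LHS]fineK ?fI //; apply: integrable_fin_num => //; exact: integrable_coord.
under eq_integral do rewrite -sumEFin.
rewrite integral_sum //; last first.
  move=> k; under eq_fun do rewrite mulrC EFinM.
  by apply: integrableZl => //; exact: integrable_coord.
apply: big1 => k _; under eq_integral do rewrite mulrC EFinM.
by rewrite integralZl ?K0 ?mule0 //; exact: integrable_coord.
Qed.

Lemma measurable_dot v : measurable_fun setT (fun x : 'rV[R]_n => \sum_k x ord0 k * v ord0 k).
Proof.
by apply: measurable_sum => k; apply: measurable_funM => //; exact: measurable_coord.
Qed.

Lemma integrable_dot K v : compact K ->
  mu.-integrable K (fun x => (\sum_k x ord0 k * v ord0 k)%:E).
Proof.
move=> cK; have mK := compact_measurable_rV cK.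
under eq_fun do rewrite -sumEFin.
apply: integrable_sum => // k _; under eq_fun do rewrite mulrC EFinM.
by apply: integrableZl => //; exact: integrable_coord.
Qed.

Lemma integrable_cst_compact K (a : R) : compact K ->
  mu.-integrable K (fun=> a%:E).
Proof.
move=> cK; apply: (measurable_bounded_integrable (f := cst a)) => //.
- exact: compact_measurable_rV.
- exact: vol_lty.
by exists `|a|; split => [|y ay x _]; [exact: num_real|exact: ltW].
Qed.

Lemma integral_affine K v (a : R) : convex_body K -> centroid K = 0 ->
  (\int[mu]_(x in K) (a + \sum_k x ord0 k * v ord0 k)%:E = a%:E * mu K)%E.
Proof.
move=> bK c0; have [cK _ _] := bK; have mK := compact_measurable_rV cK.
under eq_integral do rewrite EFinD.
rewrite integralD //; last exact: integrable_dot.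
  by rewrite centroid_dot // adde0 integral_cst.
exact: integrable_cst_compact.
Qed.

(* The mean over K of the nonnegative function l - <x, v> is l, while on a small
   cube inside K it is at least a multiple of |v_j|. *)
Lemma support_lower_bound K : convex_body K -> centroid K = 0 ->
  exists2 c : R, 0 < c & forall v l, (forall x, K x -> \sum_k x ord0 k * v ord0 k <= l) ->
  forall j, c * `|v ord0 j| <= l.
Proof.
move=> bK c0; have [cK _ [x0 /interior_segments[e e0 eK]]] := bK.
have mK := compact_measurable_rV cK.
(* Half of e, so that points of C can still be moved by d along an axis inside K. *)
pose d := e / 2; have d0 : 0 < d by rewrite divr_gt0.
pose C := box (fun j : 'I_n => `[(x0 ord0 j - d), (x0 ord0 j + d)]%classic).
have mC : measurable C by apply: measurable_box => j; exact: measurable_itv.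
have CE : mu C = ((d *+ 2) ^+ n)%:E by exact: lebesgue_rV_cube (ltW d0).
have CP y : C y -> forall j, `|y ord0 j - x0 ord0 j| <= d.
  by move=> yC j; have := yC j; rewrite /= in_itv /= ler_distl.
have CK : C `<=` K.
  move=> y /CP yC; apply: eK => j; apply: le_trans (yC j) _.
  by rewrite ler_pdivrMr // ler_pMr // ler1n.
have K0 : 0 < fine (mu K) by rewrite fine_gt0 // vol_gt0 //= vol_lty.
(* This is d vol(C) / vol(K). *)
exists (d * (d *+ 2) ^+ n / fine (mu K)).
  by rewrite divr_gt0 // mulr_gt0 // exprn_gt0 // mulrn_wgt0.
move=> v l vl j.
rewrite mulrAC ler_pdivrMr // mulrAC -lee_fin.
rewrite [X in (X <= _)%E]EFinM -CE [X in (_ <= X)%E]EFinM fineK ?vol_fin_num //.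
rewrite -(integral_affine (- v) l bK c0).
have -> : ((d * `|v ord0 j|)%:E * mu C = \int[mu]_(x in C) (d * `|v ord0 j|)%:E)%E.
  by rewrite integral_cst.
pose h (x : 'rV[R]_n) : R := l + \sum_k x ord0 k * (- v) ord0 k.
have hE x : h x = l - \sum_k x ord0 k * v ord0 k.
  by rewrite /h -sumrN; congr (_ + _); apply: eq_bigr => k _; rewrite mxE mulrN.
have mh D : measurable_fun D (fun x => (h x)%:E).
  apply/measurable_EFinP; apply: measurable_funTS; apply: measurable_funD => //.
  exact: measurable_dot.
apply: (@le_trans _ _ (\int[mu]_(x in C) (h x)%:E)%E); last first.
  apply: ge0_subset_integral => // x Kx; rewrite lee_fin hE subr_ge0; exact: vl.
apply: ge0_le_integral => // [x _|x Cx].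
  by rewrite lee_fin mulr_ge0 // ltW.
rewrite lee_fin hE lerBrDl.
(* As y lies in K, <y, v> <= l, which leaves room d|v_j| between <x, v> and l. *)
pose y := x + (d * Num.sg (v ord0 j)) *: delta_mx ord0 j.
have yE : \sum_k y ord0 k * v ord0 k = \sum_k x ord0 k * v ord0 k + d * `|v ord0 j|.
  rewrite normrEsg mulrA -sum_delta -big_split; apply: eq_bigr => k _ /=.
  by rewrite mxE mulrDl.
rewrite -yE; apply: vl; apply: eK => k; rewrite mxE addrAC.
rewrite (le_trans (ler_normD _ _)) // [leRHS](_ : e = d + d); last by rewrite /d; lra.
by apply: lerD; [exact: CP|exact: normr_sg_delta_le (ltW d0)].
Qed.

End bodies.

(** * The two volume inequalities *)

Section upper_bounds.
Context {R : realType} {n : nat}.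
Implicit Types (K : set 'rV[R]_n).
Local Notation mu := (@lebesgue_rV R n).

Lemma normr_det_int_ge1 (V : 'M[int]_n) : \det V != 0 ->
  1 <= `|\det (map_mx intr V : 'M[R]_n)|.
Proof. by move=> V0; rewrite det_map_mx -intr_norm -[1]/(1%:~R) ler_int -gtz0_ge1 normr_gt0. Qed.

Lemma mulmx_trE (V : 'M[R]_n) (x : 'rV[R]_n) i :
  (x *m V^T) ord0 i = \sum_k x ord0 k * V i k.
Proof. by rewrite mxE; apply: eq_bigr => k _; rewrite mxE. Qed.

Lemma vol_le_central_symmetral K : convex_body K ->
  (vol K <= (2 ^+ n * \prod_(1 <= i < n.+1)
     successive_minimum (polar (central_symmetral K)) i)%:E)%E.
Proof.
move=> [cK _ [x0 x0K]].
have Kx0 : K x0 by exact: interior_subset x0K.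
have [e e0 eK] := interior_segments x0K.
have [M M0 KM] := compact_coord_bounded cK.
set C := central_symmetral K.
have CM x : C x -> forall j, x ord0 j <= M.
  move=> [a Ka [b Kb <-]] j; rewrite !mxE mulrC ler_pdivrMr //.
  have := KM a Ka j; have := KM b Kb j; rewrite !ler_norml; lra.
have Ce (v : 'rV[R]_n) l : (forall x, C x -> \sum_k x ord0 k * v ord0 k <= l) ->
    forall j, e * `|v ord0 j| <= l.
  move=> vl j; pose u : 'rV[R]_n := (e * Num.sg (v ord0 j)) *: delta_mx ord0 j.
  have ue k : `|u ord0 k| <= e by exact: normr_sg_delta_le (ltW e0).
  have : C u.
    (* u is half the difference of x0 + u and x0 - u, both in K. *)
    exists (x0 + u); first by apply: eK => k; rewrite mxE addrAC subrr add0r.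
    exists (x0 - u); first apply: eK => k.
      have -> : (x0 - u) ord0 k - x0 ord0 k = - u ord0 k by rewrite !mxE; ring.
      by rewrite normrN ue.
    by rewrite opprB addrC addrA subrK scalerDr -scalerDl (_ : 2^-1 + 2^-1 = 1 :> R) ?scale1r //; lra.
  by move=> /vl; rewrite sum_delta -mulrA -normrEsg.
have [V [dV VC]] := successive_minima_basis CM e0 Ce.
set lam := successive_minimum (polar C) in VC *.
pose A : 'M[R]_n := (map_mx intr V)^T.
have uA : A \in unitmx.
  by rewrite unitmx_tr unitmxE unitfE -normr_gt0 (lt_le_trans ltr01) // normr_det_int_ge1.
have AE (x : 'rV[R]_n) i : (x *m A) ord0 i = \sum_k x ord0 k * (V i k)%:~R.
  by rewrite /A mulmx_trE; apply: eq_bigr => k _; rewrite mxE.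
have width x y i : K x -> K y -> (x *m A) ord0 i - (y *m A) ord0 i <= 2 * lam i.+1.
  move=> Kx Ky; have : C (2^-1 *: (x - y)) by exists x => //; exists y.
  move/VC => /(_ i); rewrite -AE -scalemxAl mulmxBl !mxE => ?; lra.
(* Only differences of points of K are controlled, so the box is anchored at the infimum of each
   coordinate. *)
pose a i : R := inf [set (x *m A) ord0 i | x in K].
have a_le i x : K x -> a i <= (x *m A) ord0 i.
  move=> Kx; apply: ge_inf; last by exists x.
  exists ((x0 *m A) ord0 i - 2 * lam i.+1) => _ [y Ky <-].
  by have := width x0 y i Kx0 Ky; lra.
have a_ge i x : K x -> (x *m A) ord0 i <= a i + 2 * lam i.+1.
  move=> Kx; rewrite -lerBlDr; apply: lb_le_inf; first by exists ((x0 *m A) ord0 i), x0.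
  by move=> _ [y Ky <-]; have := width x y i Kx Ky; lra.
pose D := box (fun i : 'I_n => `[(a i), (a i + 2 * lam i.+1)]%classic).
have mD : measurable D by apply: measurable_box => i; exact: measurable_itv.
have DE : mu D = (\prod_(i < n) (2 * lam i.+1))%:E.
  rewrite lebesgue_rV_segments => [|i].
    by congr EFin; apply: eq_bigr => i _; rewrite addrAC subrr add0r.
  by apply: le_trans (a_le i x0 Kx0) (a_ge i x0 Kx0).
apply: (@le_trans _ _ (mu [set x | D (x *m A)])).
  apply: le_measure; rewrite ?inE; [exact: compact_measurable_rV|exact: measurable_preimage_mulmx|].
  by move=> x Kx i /=; rewrite in_itv /= a_le // a_ge.
rewrite lebesgue_rV_mulmx // DE -EFinM lee_fin big_add1 /= big_mkord.
rewrite big_split /= prodr_const card_ord det_tr ler_piMl //.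
  by rewrite mulr_ge0 ?exprn_ge0 // prodr_ge0 // => i _; exact: successive_minimum_ge0.
by rewrite invf_le1 ?normr_det_int_ge1 // (lt_le_trans ltr01) // normr_det_int_ge1.
Qed.

Lemma vol_le_centroid K : convex_body K -> centroid K = 0 ->
  (vol K <= (n.+1%:R ^+ n / n`!%:R * \prod_(1 <= i < n.+1)
                 successive_minimum (polar K) i)%:E)%E.
Proof.
move=> bK c0; have [cK _ _] := bK; have mK := compact_measurable_rV cK.
have [M M0 KM] := compact_coord_bounded cK.
have [c cgt0 cP] := support_lower_bound bK c0.
have KM' x : K x -> forall j, x ord0 j <= M.
  by move=> Kx j; apply: le_trans (ler_norm _) (KM x Kx j).
have [V [dV VK]] := successive_minima_basis KM' cgt0 cP.
(* Positivity licenses the division by lambda_i in [A]. *)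
have lam0 (i : 'I_n) : 0 < successive_minimum (polar K) i.+1.
  by have [] := @successive_minimum_attained _ _ _ _ _ KM' cgt0 cP i.+1 (ltn_ord i).
set lam := successive_minimum (polar K) in VK lam0 *.
pose D : 'rV[R]_n := \row_i (lam i.+1)^-1.
(* The columns are v_i / lambda_i, so that x A has the coordinates z_i. *)
pose A : 'M[R]_n := (map_mx intr V)^T *m diag_mx D.
have dA : \det A = \det (map_mx intr V : 'M[R]_n) * (\prod_(i < n) lam i.+1)^-1.
  rewrite det_mulmx det_tr det_diag; congr (_ * _).
  by rewrite -prodfV; apply: eq_bigr => i _; rewrite mxE.
have P0 : 0 < \prod_(i < n) lam i.+1 by exact: prodr_gt0.
have V1 := normr_det_int_ge1 dV.
have V0 : 0 < `|\det (map_mx intr V : 'M[R]_n)| by exact: lt_le_trans V1.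
have uA : A \in unitmx.
  by rewrite unitmxE unitfE dA mulf_eq0 invr_eq0 (gt_eqF P0) orbF -normr_gt0.
have AE (x : 'rV[R]_n) i : (x *m A) ord0 i = (\sum_k x ord0 k * (V i k)%:~R) / lam i.+1.
  rewrite mulmxA mul_mx_diag !mxE; congr (_ / _).
  by apply: eq_bigr => k _; rewrite !mxE.
pose v : 'rV[R]_n := \row_k \sum_i A k i.
pose f (x : 'rV[R]_n) : R := 1 + \sum_i (x *m A) ord0 i.
have fE x : f x = 1 + \sum_k x ord0 k * v ord0 k.
  congr (_ + _); rewrite (eq_bigr (fun i => \sum_k x ord0 k * A k i)) => [|i _]; last by rewrite mxE.
  by rewrite exchange_big; apply: eq_bigr => k _; rewrite mxE mulr_sumr.
have mf : measurable_fun setT f.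
  rewrite (_ : f = fun x => 1 + \sum_k x ord0 k * v ord0 k); last exact/funext.
  by apply: measurable_funD => //; exact: measurable_dot.
have mrf : measurable_fun setT (fun x => ramp 1 (f x)).
  exact: (measurableT_comp (@measurable_ramp R 1) mf).
have rampE s : ramp 1 s = Num.max 0 s :> R.
  by rewrite /ramp expr1 divr1; case: leP.
have mO : measurable (@orthant R n) := @measurable_orthant R n.
pose P : set 'rV[R]_n := [set x | orthant (x *m A)].
have mP : measurable P by exact: measurable_preimage_mulmx.
have KP : K `<=` P.
  move=> x Kx i /=; rewrite in_itv /= AE ler_pdivrMr // mul1r; exact: VK.
rewrite /vol -[X in (X <= _)%E]mul1e -(integral_affine v 1 bK c0).
have int_f : mu.-integrable K (fun x => (f x)%:E).
  under eq_fun do rewrite fE EFinD.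
  by apply: integrableD => //; [exact: integrable_cst_compact|exact: integrable_dot].
rewrite (eq_integral (fun x => (f x)%:E)) => [|x _]; last by rewrite fE.
apply: (@le_trans _ _ (\int[mu]_(x in K) (ramp 1 (f x))%:E)%E).
  apply: le_integral => //.
    apply: le_integrable int_f => //.
      by apply/measurable_EFinP; exact: measurable_funTS.
    move=> x Kx; rewrite !abse_EFin lee_fin rampE.
    by case: (leP 0 (f x)) => // _; rewrite normr0.
  by move=> x Kx; rewrite lee_fin rampE le_max lexx orbT.
apply: (@le_trans _ _ (\int[mu]_(x in P) (ramp 1 (f x))%:E)%E).
  apply: ge0_subset_integral => //.
    by apply/measurable_EFinP; exact: measurable_funTS.
  by move=> x _; rewrite lee_fin ramp_ge0.
pose g : 'rV[R]_n -> \bar R := (fun z => (ramp 1 (1 + \sum_i z ord0 i))%:E) \_ (@orthant R n).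
have -> : (\int[mu]_(x in P) (ramp 1 (f x))%:E = \int[mu]_x g (x *m A))%E.
  rewrite integral_mkcond; apply: eq_integral => x _.
  by rewrite /g /patch.
rewrite integral_rV_mulmx //; first last.
- by move=> x; rewrite /g /patch; case: ifP => // _; rewrite lee_fin ramp_ge0.
- apply/(measurable_restrictT _ _).1 => //.
  by apply/measurable_EFinP; apply: measurable_funTS; exact: measurable_ramp_sum.
rewrite -integral_mkcond integral_ramp_orthant -EFinM lee_fin.
(* The Jacobian is the product of the lambda_i divided by |det V| >= 1. *)
rewrite big_add1 /= big_mkord dA normrM normfV (gtr0_norm P0) invfM invrK.
rewrite addn1 ramp_succ.
rewrite mulrC ler_wpM2l // ?divr_ge0 ?exprn_ge0 //.
by rewrite ler_piMl ?(ltW P0) // invf_le1.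
Qed.

End upper_bounds.

(** * Extremal bodies and unbounded ratios *)

Section extremal_bodies.
Context {R : realType} {n : nat}.
Implicit Types (K : set 'rV[R]_n).
Local Notation mu := (@lebesgue_rV R n).

Lemma convex_set_rV K :
  (forall x y (t : R), 0 <= t <= 1 -> K x -> K y -> K (t *: x + (1 - t) *: y)) ->
  convex_set (K : set (convex_lmodType 'rV[R]_n)).
Proof.
move=> KE x y t; rewrite !inE => Kx Ky.
by apply: (KE x y t%:num) => //; rewrite ge0 le1.
Qed.

Lemma segments_interior K (x0 : 'rV[R]_n) (e : R) : 0 < e ->
  (forall y : 'rV[R]_n, (forall j, `|y ord0 j - x0 ord0 j| < e) -> K y) -> interior K x0.
Proof.
move=> e0 eK; apply/nbhs_ballP; exists e => // y [_ ye]; apply: eK => j.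
by rewrite distrC; exact: ye.
Qed.

Definition cube (a b : R) : set 'rV[R]_n := box (fun=> `[a, b]%classic).

Lemma vol_cube a b : a <= b -> vol (cube a b) = ((b - a) ^+ n)%:E.
Proof. by move=> ab; rewrite /vol lebesgue_rV_segments // prodr_const card_ord. Qed.

Lemma cube_compact a b : compact (cube a b).
Proof. by apply: (@rV_compact _ _ (fun=> `[a, b]%classic)) => _; exact: segment_compact. Qed.

Lemma cube_interior a b (x : 'rV[R]_n) : (forall j, a < x ord0 j < b) -> interior (cube a b) x.
Proof.
move=> axb; pose e := \big[Num.min/1]_j Num.min (x ord0 j - a) (b - x ord0 j).
apply: (@segments_interior _ _ e) => [|y ye j].
  rewrite /e; elim/big_ind : _ => // [s t s0 t0|j _]; first by rewrite lt_min s0.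
  by rewrite lt_min !subr_gt0.
have : `|y ord0 j - x ord0 j| < Num.min (x ord0 j - a) (b - x ord0 j).
  by apply: lt_le_trans (ye j) _; exact: bigmin_le.
by rewrite lt_min /= in_itv /= !ltr_norml => /andP[/andP[? ?] /andP[? ?]]; lra.
Qed.

Lemma cube_body a b : a < b -> convex_body (cube a b).
Proof.
move=> ab; split; first exact: cube_compact.
  apply: convex_set_rV => x y t /andP[t0 t1] xK yK j.
  by have := xK j; have := yK j; rewrite /= !in_itv /= !mxE; nra.
exists (const_mx ((a + b) / 2)); apply: cube_interior => j; rewrite mxE; lra.
Qed.

(** Common end of both sharpness proofs, with v the volume of the extremal body. Since v > 0 and the
    product is nonnegative, c > 0; the product, at most 1, can then be replaced by 1. *)
Lemma le_of_minima_le1 K (c v : R) : 0 < v ->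
  (forall i, (0 < i <= n)%N -> successive_minimum (polar K) i <= 1) ->
  v <= c * \prod_(1 <= i < n.+1) successive_minimum (polar K) i -> v <= c.
Proof.
move=> v0 K1; set P := \prod_(1 <= i < n.+1) _ => vcP.
have P0 : 0 <= P by apply: prodr_ge0 => i _; exact: successive_minimum_ge0.
have P1 : P <= 1.
  rewrite /P big_add1 /= big_mkord; apply: (@le_trans _ _ (\prod_(i < n) 1)).
    by apply: ler_prod => i _; rewrite successive_minimum_ge0 (K1 i.+1 (ltn_ord i)).
  by rewrite big1.
have c0 : 0 < c by rewrite ltNge; apply/negP => c0; have := mulr_le0_ge0 c0 P0; lra.
by apply: le_trans vcP _; rewrite ger_pMr.
Qed.

Lemma central_symmetral_sharp (c : R) :
  (forall K, convex_body K ->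
    (vol K <= (c * \prod_(1 <= i < n.+1)
                successive_minimum (polar (central_symmetral K)) i)%:E)%E) ->
  2 ^+ n <= c.
Proof.
move=> /(_ (cube (-1) 1) (cube_body (gtrN ltr01))).
rewrite vol_cube ?gerN // opprK lee_fin; apply: le_of_minima_le1; first exact: exprn_gt0.
move=> i /andP[_ le_in]; apply: successive_minimum_le_coord => // _ [x xK [y yK <-]] j.
by have := xK j; have := yK j; rewrite /= !in_itv /= !mxE; lra.
Qed.

Lemma no_bound_noncentered : (1 <= n)%N ->
  ~ (exists c : R, forall K, convex_body K -> interior K 0 ->
       (vol K <= (c * \prod_(1 <= i < n.+1) successive_minimum (polar K) i)%:E)%E).
Proof.
(* Chosen with |c| e < 1: the box has volume at least 1, while its minima have product at most e^n
   <= e, by n >= 1. *)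
move=> n1 [c cP]; pose e : R := (`|c| + 1)^-1.
have c1 : 0 < `|c| + 1 by rewrite ltr_wpDl.
have e0 : 0 < e by rewrite invr_gt0.
have e1 : e <= 1 by rewrite invf_le1 // lerDr.
have /cP : convex_body (cube (- e) 1) by apply: cube_body; lra.
have : interior (cube (- e) 1) 0 by apply: cube_interior => j; rewrite mxE; lra.
move=> i0 /(_ i0); rewrite vol_cube ?lee_fin; last by lra.
set P := \prod_(1 <= i < n.+1) _ => H.
have P0 : 0 <= P by apply: prodr_ge0 => i _; exact: successive_minimum_ge0.
have Pe : P <= e.
  apply: (@le_trans _ _ (e ^+ n)); last by rewrite -{2}[e]expr1 ler_wiXn2l // ltW.
  rewrite /P big_add1 /= big_mkord -[X in _ ^+ X]card_ord -prodr_const.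
  apply: ler_prod => i _; rewrite successive_minimum_ge0 /=.
  apply: successive_minimum_le_opp_coord => // x xK j.
  by have := xK j; rewrite /= in_itv /=; lra.
have : c * P < 1.
  apply: (@le_lt_trans _ _ (`|c| * e)).
    by apply: le_trans (ler_wpM2r P0 (ler_norm c)) _; exact: ler_wpM2l.
  by rewrite ltr_pdivrMr // mul1r ltrDl.
have : 1 <= (1 - - e) ^+ n by rewrite exprn_ege1 // opprK lerDl ltW.
lra.
Qed.

(** Its vertices are (1, ..., 1) and the points (1, ..., 1) - (n+1) e_j; their mean is the
    origin. *)
Definition simplex : set 'rV[R]_n :=
  @orthant R n `&` [set x | 0 <= 1 + \sum_i x ord0 i].

Let v : R := n.+1%:R ^+ n / n`!%:R.

Lemma simplex_compact : compact simplex.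
Proof.
apply: (@subclosed_compact _ _ (cube (- 1 - n%:R) 1)); [|exact: cube_compact|].
  apply: closedI.
    rewrite (_ : @orthant R n = \bigcap_(i in [set: 'I_n]) ((fun x : 'rV[R]_n => x ord0 i) @^-1` `]-oo, 1%R]%classic)).
      apply: closed_bigI => i _; apply: closed_comp => [x _|]; first exact: coord_continuous.
      exact: lray_closed.
    apply/seteqP; split => [x xO i _|x xO i]; first exact: xO.
    exact: (xO i Logic.I).
  apply: (@closed_comp _ _ (fun x : 'rV[R]_n => 1 + \sum_i x ord0 i) [set s | 0 <= s]) => [x _|]; last exact: closed_ge.
  apply: continuousD; first exact: cst_continuous.
  have cS : continuous (fun x : 'rV[R]_n => \sum_i x ord0 i).
    by apply: continuous_big => [|i _]; [exact: add_continuous|exact: coord_continuous].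
  exact: cS.
move=> x [xO /= xs] j; rewrite /= in_itv /=; have := xO j; rewrite /= in_itv /= => ->.
rewrite andbT; move: xs; rewrite (bigD1 j) //=.
suff : \sum_(i < n | i != j) x ord0 i <= n%:R by lra.
apply: (@le_trans _ _ (\sum_(i < n | i != j) 1)).
  by apply: ler_sum => i _; have := xO i; rewrite /= in_itv.
rewrite sumr_const ler_nat; apply: leq_trans (max_card _) _; by rewrite card_ord.
Qed.

Lemma simplex_body : convex_body simplex.
Proof.
split; first exact: simplex_compact.
  apply: convex_set_rV => x y t /andP[t0 t1] [xO /= xs] [yO /= ys]; split => [j|/=].
    by have := xO j; have := yO j; rewrite /= !in_itv /= !mxE; nra.
  rewrite (eq_bigr (fun j => t * x ord0 j + (1 - t) * y ord0 j)) => [|j _]; last by rewrite !mxE.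
  by rewrite big_split /= -!mulr_sumr; nra.
(* Coordinates above -1/(n+1) have sum at least -n/(n+1) > -1. *)
have e0 : 0 < n.+1%:R^-1 :> R by rewrite invr_gt0.
exists 0; apply: (@segments_interior _ _ n.+1%:R^-1) => // y ye; split => [j|/=].
  rewrite /= in_itv /=; have := ye j; rewrite mxE subr0 => /ltW /(le_trans (ler_norm _)) /le_trans.
  by apply; rewrite invf_le1 // ler1n.
have : \sum_(j < n) - n.+1%:R^-1 <= \sum_j y ord0 j.
  by apply: ler_sum => j _; have := ye j; rewrite mxE subr0 ltr_norml => /andP[/ltW].
rewrite sumr_const card_ord -lerBlDl sub0r; apply: le_trans.
rewrite mulNrn lerN2 -[X in X <= _]mulr_natl ler_pdivrMr // mul1r ler_nat; exact: leqnSn.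
Qed.

(** The ramp vanishes on the rest of the orthant. The case k = 0 gives the volume, k = 1 the
    integral of 1 + x_1 + ... + x_n. *)
Lemma integral_simplex_ramp k :
  (\int[mu]_(x in simplex) (ramp k (1 + \sum_i x ord0 i))%:E = (ramp (n + k) (1 + n%:R))%:E)%E.
Proof.
rewrite -integral_ramp_orthant integral_mkcond [RHS]integral_mkcond.
apply: eq_integral => x _; rewrite /patch /simplex in_setI.
have -> : (x \in [set y : 'rV[R]_n | 0 <= 1 + \sum_i y ord0 i]) = (0 <= 1 + \sum_i x ord0 i).
  by apply/idP/idP; rewrite inE.
case: (x \in @orthant R n) => //=.
by rewrite /ramp; case: (0 <= 1 + \sum_i x ord0 i).
Qed.

Lemma vol_simplex : vol simplex = v%:E.
Proof.
rewrite /vol -[LHS]mul1e -integral_cst; last exact: compact_measurable_rV simplex_compact.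
transitivity (\int[mu]_(x in simplex) (ramp 0 (1 + \sum_i x ord0 i))%:E)%E.
  apply: eq_integral => x; rewrite inE => -[_ /= xs].
  by rewrite /ramp xs expr0 divr1.
by rewrite integral_simplex_ramp addn0 /ramp addrC natr1 ler0n.
Qed.

(** Exchanging two coordinates preserves the simplex and the measure. The function 1 - x_i replaces
    x_i because the change of variables is for nonnegative integrands. *)
Lemma integral_coord_simplex_sym i j :
  (\int[mu]_(x in simplex) (1 - x ord0 i)%:E = \int[mu]_(x in simplex) (1 - x ord0 j)%:E)%E.
Proof.
pose g k : 'rV[R]_n -> \bar R := (fun x => (1 - x ord0 k)%:E) \_ simplex.
rewrite integral_mkcond [RHS]integral_mkcond -/(g i) -/(g j).
pose P : 'M[R]_n := perm_mx (tperm i j).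
have xP (x : 'rV[R]_n) k : (x *m P) ord0 (tperm i j k) = x ord0 k.
  exact: mulmx_permE.
have xS (x : 'rV[R]_n) : (x *m P \in simplex) = (x \in simplex).
  have sumP : \sum_k (x *m P) ord0 k = \sum_k x ord0 k.
    by rewrite (reindex_perm (tperm i j)); apply: eq_bigr => k _; rewrite xP.
  apply/idP/idP; rewrite !inE => -[xO /= xs]; split.
  - by move=> k; rewrite -xP; exact: xO.
  - by rewrite /= -sumP.
  - by move=> k; rewrite -(tpermK i j k) xP; exact: xO.
  - by rewrite /= sumP.
transitivity (\int[mu]_x g j (x *m P))%E.
  apply: eq_integral => x _; rewrite /g /patch xS.
  by have := xP x i; rewrite tpermL => ->.
rewrite integral_rV_mulmx ?unitmx_perm // ?det_perm ?normr_sign ?invr1 ?mul1e //.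
  apply/(measurable_restrictT _ _).1; first exact: compact_measurable_rV simplex_compact.
  apply/measurable_EFinP; apply: measurable_funTS; apply: measurable_funB => //; exact: measurable_coord.
move=> x; rewrite /g /patch; case: ifPn => //; rewrite inE => -[xO _].
by rewrite lee_fin subr_ge0; have := xO j; rewrite /= in_itv.
Qed.

(** By symmetry all coordinates have the same integral, and these integrals sum to 0 because 1 + x_1
    + ... + x_n integrates to the volume. *)
Lemma centroid_simplex : centroid simplex = 0.
Proof.
have cS := simplex_compact; have mS := compact_measurable_rV cS.
have iS k := integrable_coord k cS.
pose r k : R := fine (\int[mu]_(x in simplex) (x ord0 k)%:E)%E.
have rE k : (\int[mu]_(x in simplex) (x ord0 k)%:E = (r k)%:E)%E.
  by rewrite fineK //; exact: integrable_fin_num (iS k).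
have i1 : (\int[mu]_(x in simplex) 1%:E = v%:E)%E.
  by rewrite integral_cst // mul1e; exact: vol_simplex.
have rB k : (\int[mu]_(x in simplex) (1 - x ord0 k)%:E = (v - r k)%:E)%E.
  under eq_integral do rewrite EFinB.
  rewrite integralB //; last exact: integrable_cst_compact.
  by rewrite i1 rE.
have r_eq i j : r i = r j.
  by have := integral_coord_simplex_sym i j; rewrite !rB => -[] /addrI /oppr_inj.
have r_sum : \sum_k r k = 0.
  have : (\int[mu]_(x in simplex) (ramp 1 (1 + \sum_i x ord0 i))%:E = v%:E)%E.
    by rewrite integral_simplex_ramp addn1 ramp_succ.
  rewrite (eq_integral (fun x : 'rV[R]_n => 1%:E + \sum_i (x ord0 i)%:E)%E); last first.
    move=> x; rewrite inE => -[_ /= xs].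
    by rewrite /ramp xs expr1 divr1 sumEFin.
  rewrite integralD //; [|exact: integrable_cst_compact|]; last exact: integrable_sum.
  rewrite i1 integral_sum //.
  under eq_bigr do rewrite rE.
  by rewrite sumEFin -EFinD => -[] /eqP; rewrite -subr_eq0 addrAC subrr add0r => /eqP.
apply/rowP => i; rewrite !mxE /Rintegral -/(r i).
suff -> : r i = 0 by rewrite mul0r.
move: r_sum; rewrite (eq_bigr (fun=> r i)) => [|k _]; last exact: r_eq.
rewrite sumr_const card_ord => /eqP; rewrite mulrn_eq0 => /orP[/eqP n0|/eqP //].
by have := leq_ltn_trans (leq0n i) (ltn_ord i); rewrite n0.
Qed.

Lemma centroid_sharp (c : R) :
  (forall K, convex_body K -> centroid K = 0 ->
    (vol K <= (c * \prod_(1 <= i < n.+1) successive_minimum (polar K) i)%:E)%E) ->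
  n.+1%:R ^+ n / n`!%:R <= c.
Proof.
move=> /(_ simplex simplex_body centroid_simplex); rewrite vol_simplex lee_fin.
apply: le_of_minima_le1; first by rewrite divr_gt0 ?exprn_gt0 ?ltr0n ?fact_gt0.
move=> i /andP[_ le_in]; apply: successive_minimum_le_coord => // x [xO _] j.
by have := xO j; rewrite /= in_itv.
Qed.

End extremal_bodies.

Theorem theorem1p2 (R : realType) (n : nat) (hn : (1 <= n)%N) :
  (* (1) *)
  ((forall K : set 'rV[R]_n, convex_body K ->
     (vol K <= (2 ^+ n * \prod_(1 <= i < n.+1)
                 successive_minimum (polar (central_symmetral K)) i)%:E)%E)
   /\
   (forall c : R,
     (forall K : set 'rV[R]_n, convex_body K ->
       (vol K <= (c * \prod_(1 <= i < n.+1)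
                   successive_minimum (polar (central_symmetral K)) i)%:E)%E) ->
     2 ^+ n <= c))
  /\
  (* (2) *)
  ((forall K : set 'rV[R]_n, convex_body K -> centroid K = 0 ->
     (vol K <= (n.+1%:R ^+ n / n`!%:R * \prod_(1 <= i < n.+1)
                 successive_minimum (polar K) i)%:E)%E)
   /\
   (forall c : R,
     (forall K : set 'rV[R]_n, convex_body K -> centroid K = 0 ->
       (vol K <= (c * \prod_(1 <= i < n.+1)
                   successive_minimum (polar K) i)%:E)%E) ->
     n.+1%:R ^+ n / n`!%:R <= c))
  /\
  (* (3) *)
  ~ (exists c : R, forall K : set 'rV[R]_n, convex_body K -> interior K 0 ->
       (vol K <= (c * \prod_(1 <= i < n.+1)
                   successive_minimum (polar K) i)%:E)%E).

Proof.
split; [split|split; [split|]].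
- exact: vol_le_central_symmetral.
- exact: central_symmetral_sharp.
- exact: vol_le_centroid.
- exact: centroid_sharp.
- exact: no_bound_noncentered.
Qed.
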